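(* Let $H$ be a hypergraph having at least two distinct edges with nonempty intersection, and assume that $H$ has the private intersection property. Then $\mathfrak R(H)\le 1$.
   Context: Hypergraphs $H=(V,E)$ are finite, with $E\subseteq 2^V$, and have no isolated vertices. For a set of sets $X$, $\bigcup X$ is the union of its members ($\bigcup\emptyset=\emptyset$). $\deg_H(v)$ is the number of edges containing $v$. $H$ has the private intersection property if for all distinct $x,y\in E$ with $x\cap y\ne\emptyset$ there exists $v_{xy}\in x\cap y$ with $\deg_H(v_{xy})=2$. $\mathbf 1\text{-}\mathsf{Sub}(H)$ is the set of functions $b:2^V\to\mathbb R_{\ge0}$ that are normalised ($b(\emptyset)=0$), monotone, submodular, and satisfy $b(X)\le 1$ for all $e\in E$, $X\subseteq e$. For $F\subseteq E$, $\partial_H(F):=(\bigcup F)\cap(\bigcup(E\setminus F))$ and $\lambda_b(F):=b(\partial_H(F))$. $K^{\mathsf{Sub}}_{\mathbf 1}(H):=\{q\in\mathbb R_{\ge0}^{2^E}: \exists b\in\mathbf 1\text{-}\mathsf{Sub}(H)\text{ with } q\le\lambda_b\text{ pointwise}\}$, and $\gamma_H^{\mathsf{Sub}}(q):=\inf\{\alpha\ge0: q\in\alpha\cdot K^{\mathsf{Sub}}_{\mathbf 1}(H)\}$ ($+\infty$ if no such $\alpha$). The line graph $M=P(H^* )$ has vertex set $E(H)$, with distinct $e,f$ adjacent iff $e\cap f\ne\emptyset$. For $\alpha:E(M)\to\mathbb R_{\ge0}$ and $F\subseteq E(H)$, $q_{M,\alpha}(F):=\sum\{\alpha_{xy}: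 xy\in E(M), x\in F, y\notin F\}$; $\alpha(\mathrm{Inc}_M(e))$ is the sum of $\alpha$ over the edges of $M$ incident with $e$. The submodular gauge-routing ratio is \[ \mathfrak R(H):=\sup_{\alpha\ne0}\frac{\gamma_H^{\mathsf{Sub}}(q_{M,\alpha})}{\max_{e\in E(H)}\alpha(\mathrm{Inc}_M(e))}, \] the supremum being over all nonzero $\alpha:E(M)\to\mathbb R_{\ge0}$. *)

(* Defs.v *)
From mathcomp Require Import all_boot all_order all_algebra.
From mathcomp Require Import classical_sets reals constructive_ereal ereal.

Set Implicit Arguments.
Unset Strict Implicit.
Unset Printing Implicit Defensive.

Import Order.TTheory GRing.Theory Num.Theory.

Local Open Scope ring_scope.

Record hypergraph (V : finType) := Hypergraph {
  edges : {set {set V}};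
  no_isolated : forall v : V, exists2 e, e \in edges & v \in e }.

(* Edges as a finite type, so that sets of edges F \subset E are exactly the
   elements of {set hedge H}, with complement E \ F given by ~: F. *)
Definition hedge (V : finType) (H : hypergraph V) : predArgType :=
  {e : {set V} | e \in edges H}.

Section Hypergraph.
Variables (V : finType) (H : hypergraph V).

Definition hdeg (v : V) : nat := #|[set e : hedge H | v \in val e]%SET|.

Definition intersecting (x y : hedge H) : bool := val x :&: val y != finset.set0.

Definition private_intersection : Prop :=
  forall x y : hedge H, x != y -> intersecting x y ->
    exists2 v : V, v \in val x :&: val y & hdeg v = 2%N.

Definition hunion (F : {set hedge H}) : {set V} := (\bigcup_(e in F) val e)%SET.

Definition boundary (F : {set hedge H}) : {set V} := hunion F :&: hunion (~: F).

Definition line_adj (x y : hedge H) : bool := (x != y) && intersecting x y.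

(* E(M): unordered pairs of adjacent vertices of the line graph M. *)
Definition line_edges : {set {set hedge H}} :=
  [set p | [exists x : hedge H, exists y : hedge H,
     line_adj x y && (p == [set x; y])]]%SET.

End Hypergraph.

Definition ledge (V : finType) (H : hypergraph V) : predArgType :=
  {p : {set hedge H} | p \in line_edges H}.

Section Gauge.
Variables (R : realType) (V : finType) (H : hypergraph V).

Record one_sub (b : {set V} -> R) : Prop := OneSub {
  one_sub_ge0 : forall X, 0 <= b X;
  one_sub_normalised : b finset.set0 = 0;
  one_sub_monotone : forall X Y : {set V}, X \subset Y -> b X <= b Y;
  one_sub_submodular :
    forall X Y : {set V}, b (X :|: Y) + b (X :&: Y) <= b X + b Y;
  one_sub_le1 :
    forall e X : {set V}, e \in edges H -> X \subset e -> b X <= 1 }.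

Definition blambda (b : {set V} -> R) (F : {set hedge H}) : R :=
  b (boundary F).

Definition Ksub : set ({set hedge H} -> R) :=
  [set q | (forall F, 0 <= q F) /\
           exists2 b, one_sub b & forall F, q F <= blambda b F]%classic.

(* ereal_inf of the empty set is +oo. *)
Definition gauge (q : {set hedge H} -> R) : \bar R :=
  ereal_inf [set a%:E | a in
    [set a : R | 0 <= a /\
       [set (fun F => a * k F) | k in Ksub] q]]%classic.

Definition cut_demand (alpha : ledge H -> R) (F : {set hedge H}) : R :=
  \sum_(p : ledge H |
     [exists x in F, exists y in ~: F, val p == [set x; y]%SET]) alpha p.

Definition inc_weight (alpha : ledge H -> R) (e : hedge H) : R :=
  \sum_(p : ledge H | e \in val p) alpha p.

(* The default 0 of the maximum is harmless: weights are nonnegative. *)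
Definition max_inc (alpha : ledge H -> R) : R :=
  \big[Num.max/0]_(e : hedge H) inc_weight alpha e.

(* For alpha as below, max_inc alpha > 0, so the division is a genuine one. *)
Definition gauge_routing_ratio : \bar R :=
  ereal_sup [set (gauge (cut_demand alpha) / (max_inc alpha)%:E)%E | alpha in
    [set alpha : ledge H -> R |
       (forall p, 0 <= alpha p) /\ exists p, alpha p != 0]]%classic.

End Gauge.

(* Main.v *)
Require Import Defs.
From mathcomp Require Import all_boot all_order all_algebra.
From mathcomp Require Import classical_sets reals constructive_ereal ereal.

(** For each edge [p = xy] of the line graph pick a private vertex [v p] of
    [x :&: y]. Placing mass [alpha p] at [v p] and dividing by the maximal
    incident weight [m] gives a modular function [b]: the vertices [v p] in a
    hyperedge [e] are exactly those of the [p] incident with [e], so [b <= 1]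
    on [e]; and if [p] crosses the cut [F] then [v p] lies in the boundary of
    [F], so [cut_demand alpha <= m * blambda b]. *)

Set Implicit Arguments.
Unset Strict Implicit.
Unset Printing Implicit Defensive.

Import Order.TTheory GRing.Theory Num.Theory.

Local Open Scope ring_scope.

Lemma ledge_ends (V : finType) (H : hypergraph V) (p : ledge H) :
  exists x y : hedge H, [/\ x != y, intersecting x y & val p = [set x; y]%SET].
Proof.
have := valP p; rewrite inE => /existsP[x /existsP[y /andP[/andP[nxy ixy]]]].
by move=> /eqP pE; exists x, y.
Qed.

(** The two ends of [p] both contain the private vertex, and its degree is 2, so inclusion and equal
    cardinality leave no other hyperedge through it. *)
Lemma private_vertex (V : finType) (H : hypergraph V) (p : ledge H) :
  private_intersection H ->
  exists v : V, forall e : hedge H, (v \in val e) = (e \in val p).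
Proof.
move=> hpriv; have [x [y [nxy ixy ->]]] := ledge_ends p.
have [v /setIP[vx vy] dv] := hpriv x y nxy ixy; exists v => e.
suff /eqP/setP/(_ e) -> : [set x; y]%SET == [set e : hedge H | v \in val e]%SET.
  by rewrite inE.
by rewrite eqEcard finset.subUset !finset.sub1set !inE vx vy cards2 nxy [#|_|]dv.
Qed.

Section Weights.
Variables (R : realType) (V : finType) (H : hypergraph V).
Variables (alpha : ledge H -> R) (alpha_ge0 : forall p, 0 <= alpha p).

Lemma inc_weight_le_max (e : hedge H) : inc_weight alpha e <= max_inc alpha.
Proof. exact: (le_bigmax _ (inc_weight alpha)). Qed.

(** Either end of a line edge of nonzero weight already has positive incident weight. *)
Lemma max_inc_gt0 : (exists p, alpha p != 0) -> 0 < max_inc alpha.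
Proof.
move=> [p ap]; have [x [y [_ _ pE]]] := ledge_ends p.
apply: lt_le_trans (inc_weight_le_max x).
rewrite /inc_weight (bigD1 p) /=; last by rewrite pE !inE eqxx.
by rewrite ltr_pwDl ?lt0r ?ap ?alpha_ge0 ?sumr_ge0.
Qed.

Lemma cut_demand_ge0 (F : {set hedge H}) : 0 <= cut_demand alpha F.
Proof. exact: sumr_ge0. Qed.

Variable v : ledge H -> V.
Hypothesis vP : forall p (e : hedge H), (v p \in val e) = (e \in val p).

(** Summing over line edges rather than vertices counts each [alpha p] at most once, without appeal
    to injectivity of [v]. *)
Definition vertex_mass (X : {set V}) : R := \sum_(p | v p \in X) alpha p.

Lemma vertex_mass_mono (X Y : {set V}) :
  X \subset Y -> vertex_mass X <= vertex_mass Y.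
Proof.
move=> sXY; rewrite /vertex_mass big_mkcond [leRHS]big_mkcond.
by apply: ler_sum => p _; case: ifP => [/(fintype.subsetP sXY)->|_] //; case: ifP.
Qed.

(** Termwise: [alpha p] occurs on either side twice, once or never, as [v p] lies in both, exactly
    one or neither of [X] and [Y]. *)
Lemma vertex_mass_modular (X Y : {set V}) :
  vertex_mass (X :|: Y) + vertex_mass (X :&: Y) = vertex_mass X + vertex_mass Y.
Proof.
rewrite /vertex_mass !(big_mkcond (fun p => v p \in _)) -!big_split.
apply: eq_bigr => p _ /=.
by rewrite !inE; do 2![case: (v p \in _)]; rewrite //= addrC.
Qed.

Lemma vertex_mass_hedge (e : hedge H) : vertex_mass (val e) = inc_weight alpha e.
Proof. by apply: eq_bigl => p; rewrite vP. Qed.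

Lemma cut_demand_le_vertex_mass (F : {set hedge H}) :
  cut_demand alpha F <= vertex_mass (boundary F).
Proof.
(* Both sums now run over all [p], with 0 off the condition; a [p] that does not cross the cut costs
   nothing as [alpha] is nonnegative. *)
rewrite /cut_demand big_mkcond /vertex_mass [leRHS]big_mkcond.
apply: ler_sum => p _; case: ifP => [|_]; last by case: ifP.
move=> /existsP[x /andP[xF /existsP[y /andP[yF /eqP pE]]]].
rewrite ifT // inE; apply/andP; split; apply/bigcupP.
  by exists x; rewrite // vP pE !inE eqxx.
by exists y; rewrite // vP pE !inE eqxx orbT.
Qed.

Lemma one_sub_vertex_mass : 0 < max_inc alpha ->
  one_sub H (fun X => vertex_mass X / max_inc alpha).
Proof.
move=> m_gt0; split=> [X||X Y sXY|X Y|e X eH sXe].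
- by rewrite divr_ge0 ?sumr_ge0 ?ltW.
- by rewrite /vertex_mass big_pred0 ?mul0r // => p; rewrite inE.
- by rewrite ler_pM2r ?invr_gt0 ?vertex_mass_mono.
- by rewrite -!mulrDl vertex_mass_modular.
rewrite ler_pdivrMr // mul1r (le_trans (vertex_mass_mono sXe)) //.
by rewrite (vertex_mass_hedge (Sub e eH : hedge H)) inc_weight_le_max.
Qed.

Lemma gauge_cut_demand_le : 0 < max_inc alpha ->
  (gauge (cut_demand alpha) <= (max_inc alpha)%:E)%E.
Proof.
move=> m_gt0; apply: ereal_inf_lbound; exists (max_inc alpha) => //.
split; first exact: ltW.
(* The scale is the maximal incident weight, so the point required in [Ksub] is the demand divided
   by it. *)
exists (fun F => cut_demand alpha F / max_inc alpha); last first.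
  by apply: boolp.funext => F; rewrite mulrC divfK ?gt_eqF.
split=> [F|]; first by rewrite divr_ge0 ?cut_demand_ge0 ?ltW.
exists (fun X => vertex_mass X / max_inc alpha).
  exact: one_sub_vertex_mass.
by move=> F; rewrite ler_pM2r ?invr_gt0 ?cut_demand_le_vertex_mass.
Qed.

End Weights.

Theorem proposition6p6 (R : realType) (V : finType) (H : hypergraph V)
    (hmeet : exists x y : hedge H, x != y /\ intersecting x y)
    (hprivate : private_intersection H) :
  (gauge_routing_ratio R H <= 1)%E.
Proof.
apply: ge_ereal_sup => _ [alpha [alpha_ge0 alpha_neq0] <-].
have m_gt0 := max_inc_gt0 alpha_ge0 alpha_neq0.
(* Finite choice turns the private vertices into a function on line edges. *)
have [v vP] := fin_all_exists (fun p : ledge H => private_vertex p hprivate).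
(* Inversion in [\bar R] treats 0 separately; [m_gt0] selects the real inverse. *)
by rewrite inver gt_eqF // lee_pdivrMr // mul1e (gauge_cut_demand_le alpha_ge0 vP).
Qed.
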